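(* Let $m,n,s,k,t$ be positive integers. If there is a simple $\mathrm{H}_t(m,n;s,k)$, then there exist a $(2ms+t,\,t,\,C_s,\,1)$-difference family and a $(2nk+t,\,t,\,C_k,\,1)$-difference family.
   Context: A partially filled (p.f.) $m\times n$ array is an $m\times n$ matrix in which some cells are allowed to be empty. Let $v=2nk+t$ with $t$ dividing $2nk$, and let $J$ be the subgroup of $\mathbb{Z}_v$ of order $t$. An $\mathrm{H}_t(m,n;s,k)$ (Heffter array over $\mathbb{Z}_v$ relative to $J$) is an $m\times n$ p.f. array with elements in $\mathbb{Z}_v$ such that: each row contains exactly $s$ filled cells and each column contains exactly $k$ filled cells (so $ms=nk$); for every $x\in\mathbb{Z}_v\setminus J$, either $x$ or $-x$ appears in the array; the elements in every row and every column sum to $0$ in $\mathbb{Z}_v$. An ordering $(t_1,\ldots,t_\ell)$ of a finite subset of an abelian group is simple if the partial sums $s_i=\sum_{j=1}^i t_j$, $i=1,\ldots,\ell$, are pairwise distinct. A p.f. array with entries in an abelian group is simple if for each row and each column there is a simple ordering of its elements. $C_\ell$ denotes the cycle of length $\ell$. For a graph $\Gamma$ with vertices in an additive group $G$, the list of differences is the multiset $\Delta\Gamma=\{\pm(x-y)\mid \{x,y\}\in E(\Gamma)\}$ (each edge contributes both $x-y$ and $y-x$); for a collection $\mathcal{F}$ of such graphs, $\Delta\mathcal{F}$ is the multiset union of the $\Delta\Gamma$, $\Gamma\in\mathcal{F}$. For $t$ dividing $v$, a $(v,t,\Gamma,\lambda)$-difference family is a collection $\mathcal{F}$ of graphs isomorphic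 to $\Gamma$ with vertices in $\mathbb{Z}_v$ such that each element of $\mathbb{Z}_v\setminus J$ appears exactly $\lambda$ times in $\Delta\mathcal{F}$ and no element of $J$ appears in it, where $J$ is the subgroup of $\mathbb{Z}_v$ of order $t$. *)

(* Defs.v *)
From HB Require Import structures.
From mathcomp Require Import all_boot all_order all_algebra all_fingroup.

Set Implicit Arguments.
Unset Strict Implicit.
Unset Printing Implicit Defensive.

Import GRing.Theory.

(** Partially filled arrays: [None] is an empty cell. *)

Section Arrays.
Variables (G : zmodType) (m n : nat).
Implicit Type A : 'M[option G]_(m, n).

Definition row_entries A (i : 'I_m) : seq G := pmap (fun j => A i j) (enum 'I_n).
Definition col_entries A (j : 'I_n) : seq G := pmap (fun i => A i j) (enum 'I_m).

(* [scanl +%R 0 T] does not include the initial value 0: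
   it is [:: t_1; t_1 + t_2; ...; t_1 + ... + t_l]. *)
Definition simple_ordering (T : seq G) : bool := uniq (scanl +%R 0%R T).

Definition has_simple_ordering (B : seq G) : Prop :=
  exists2 T : seq G, perm_eq T B & simple_ordering T.

Definition simple_array A : Prop :=
  (forall i, has_simple_ordering (row_entries A i)) /\
  (forall j, has_simple_ordering (col_entries A j)).

End Arrays.

(* ['Z_v] is the ring of integers mod v only for [1 < v]; this holds here for
   positive n, k and t.  The group structure of ['Z_v] used in [{group 'Z_v}]
   is the additive one. *)
Definition heffter (m n s k t : nat)
    (A : 'M[option 'Z_(2 * n * k + t)]_(m, n)) : Prop :=
  t %| 2 * n * k /\
  exists2 J : {group 'Z_(2 * n * k + t)}, #|J| = t &
    [/\ forall i, size (row_entries A i) = s,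
        forall j, size (col_entries A j) = k,
        forall x, x \notin J ->
          exists i j, A i j = Some x \/ A i j = Some (- x)%R,
        forall i, (\sum_(x <- row_entries A i) x = 0)%R
      & forall j, (\sum_(x <- col_entries A j) x = 0)%R].

Arguments heffter m n s k t A : clear implicits.

(** Finite simple graphs whose vertex set is a subset of [T]. *)

Section Graphs.
Variable T : finType.

Definition graph_axiom (VE : {set T} * {set {set T}}) : bool :=
  [forall e in VE.2, (e \subset VE.1) && (#|e| == 2)].

Record graph := Graph { graph_val :> {set T} * {set {set T}};
                        _ : graph_axiom graph_val }.

HB.instance Definition _ := [isSub for graph_val].
HB.instance Definition _ := [Equality of graph by <:].

Definition vertices (g : graph) : {set T} := (graph_val g).1.
Definition edges (g : graph) : {set {set T}} := (graph_val g).2.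

End Graphs.

Definition isomorphic (T U : finType) (g : graph T) (h : graph U) : Prop :=
  exists f : T -> U,
    [/\ {in vertices g &, injective f},
        f @: vertices g = vertices h
      & {in vertices g &, forall x y,
          ([set x; y] \in edges g) = ([set f x; f y] \in edges h)}].

(* [ordS i] is i + 1 mod l.  The requirement [#|e| == 2] only matters for the
   degenerate value l = 1, where it removes the loop. *)
Definition cycle_edges (l : nat) : {set {set 'I_l}} :=
  [set e in [set [set i; ordS i] | i : 'I_l] | #|e| == 2].

Fact cycle_graph_axiom (l : nat) : graph_axiom ([set: 'I_l], cycle_edges l).
Proof.
by apply/forall_inP => e; rewrite inE subsetT => /andP[].
Qed.

Definition cycle_graph (l : nat) : graph 'I_l := Graph (cycle_graph_axiom l).

(* The list ranges over ordered pairs, so that each edge {x, y} contributes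
   both x - y and y - x. *)
Definition differences (G : finZmodType) (g : graph G) : seq G :=
  [seq (p.1 - p.2)%R | p in [pred p : G * G | [set p.1; p.2] \in edges g]].

Definition family_differences (G : finZmodType) (F : seq (graph G)) : seq G :=
  flatten [seq differences g | g <- F].

(* As in [heffter], ['Z_v] is the intended group only for [1 < v]. *)
Definition difference_family (v t : nat) (U : finType) (C : graph U)
    (lambda : nat) (F : seq (graph 'Z_v)) : Prop :=
  t %| v /\
  exists2 J : {group 'Z_v}, #|J| = t &
    [/\ forall g, g \in F -> isomorphic g C,
        forall x, x \notin J -> count_mem x (family_differences F) = lambda
      & forall x, x \in J -> x \notin family_differences F].

Arguments difference_family v t {U} C lambda F.

(* Main.v *)
(** A row (or column) whose ordering T has pairwise distinct partial sums and
    total 0 yields the cycle through these partial sums: consecutive vertices,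
    including the last and the first, differ by an element of T.  The p blocks
    of size l give at most 2 p l differences in all, and these cover the 2 p l
    elements outside J; hence each of them occurs exactly once and no element
    of J occurs. *)

Require Import Defs.
From mathcomp Require Import all_boot all_order all_algebra all_fingroup.

Set Implicit Arguments.
Unset Strict Implicit.
Unset Printing Implicit Defensive.

Import GRing.Theory.

Lemma eq_set2 (T : finType) (a b c d : T) :
  [set a; b] = [set c; d] -> (a = c /\ b = d) \/ (a = d /\ b = c).
Proof.
move=> e; have [ha hb] : a \in [set c; d] /\ b \in [set c; d].
  by rewrite -e !inE !eqxx orbT.
have [hc hd] : c \in [set a; b] /\ d \in [set a; b] by rewrite e !inE !eqxx orbT.
by case/set2P: ha hb hc hd => -> /set2P[] -> /set2P[] ? /set2P[] ?; auto.
Qed.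

Section GraphImage.
Variables (T U : finType) (f : U -> T) (C : graph U).
Hypothesis f_inj : injective f.

Fact image_graph_axiom :
  graph_axiom (f @: vertices C, [set f @: e | e : {set U} in edges C]).
Proof.
apply/forall_inP => _ /imsetP[e eC ->]; case: C eC => g gP eC.
by have /andP[eV e2] := forall_inP gP e eC; rewrite imsetS //= card_imset.
Qed.

Definition image_graph : graph T := Graph image_graph_axiom.

Lemma mem_edges_image_graph x y :
  ([set f x; f y] \in edges image_graph) = ([set x; y] \in edges C).
Proof.
rewrite -imset_set1 -[[set f y]]imset_set1 -imsetU.
exact: mem_imset (imset_inj f_inj).
Qed.

Lemma image_graph_isomorphic (u0 : U) : isomorphic image_graph C.
Proof.
(* The isomorphism runs from the image back to [C], so it is an inverse of [f]; [u0] is its dummy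
   value off the image of [f]. *)
pose g y := odflt u0 [pick x | f x == y].
have fK : cancel f g.
  move=> x; rewrite /g; case: pickP => [z /eqP/f_inj //|/(_ x)].
  by rewrite eqxx.
exists g; split.
- by move=> _ _ /imsetP[x _ ->] /imsetP[y _ ->]; rewrite !fK => ->.
- by rewrite -imset_comp (eq_imset _ fK) imset_id.
- move=> _ _ /imsetP[x _ ->] /imsetP[y _ ->].
  by rewrite mem_edges_image_graph !fK.
Qed.

End GraphImage.

Section CycleOfOrdering.
Variables (G : finZmodType) (T : seq G).
Local Notation l := (size T).
Hypothesis T_simple : simple_ordering T.
Hypothesis T_sum0 : (\sum_(x <- T) x = 0)%R.

(** Vertex [i] already includes entry [i], so entry [i] of [T] is the step arriving at vertex [i],
    not the one leaving it. *)
Definition partial_sum (i : 'I_l) : G := nth 0%R (scanl +%R 0%R T) i.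

Lemma partial_sum_inj : injective partial_sum.
Proof.
move=> i j /eqP; rewrite nth_uniq ?size_scanl ?ltn_ord // => /eqP.
exact: val_inj.
Qed.

(** The only case beyond the recursion for partial sums is the wrap-around: the last vertex is the
    total 0, so adding the first entry to it gives the first vertex. This is where the zero sum
    closes the cycle. *)
Lemma partial_sum_ordS (i : 'I_l) :
  partial_sum (ordS i) = (partial_sum i + nth 0 T (ordS i))%R.
Proof.
rewrite /partial_sum !nth_scanl ?ltn_ord //=.
have [ltSi | leSi] := ltnP i.+1 l.
  by rewrite modn_small // (take_nth 0%R) // foldl_rcons.
have eSi : i.+1 = l by apply/eqP; rewrite eqn_leq leSi ltn_ord.
have T_gt0 : 0 < l by rewrite -eSi.
rewrite eSi modnn take_size (take_nth 0%R) // take0 /= [in RHS]foldl_idx.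
by rewrite T_sum0.
Qed.

Definition partial_sum_cycle : graph G :=
  image_graph (cycle_graph l) partial_sum_inj.

(** If [ordS i] were [i], the recurrence would make the entry zero; a nonzero entry thus never
    yields the loop that [cycle_edges] discards. *)
Lemma partial_sum_edge (i : 'I_l) : nth 0%R T (ordS i) != 0%R ->
  [set partial_sum (ordS i); partial_sum i] \in edges partial_sum_cycle.
Proof.
move=> Ti_neq0; rewrite mem_edges_image_graph inE setUC cards2.
rewrite (imset_f (fun i => [set i; ordS i])) //=.
suff -> : i != ordS i by [].
apply: contraNneq Ti_neq0 => /(congr1 partial_sum)/eqP.
by rewrite partial_sum_ordS -subr_eq0 opprD addNKr oppr_eq0.
Qed.

Lemma mem_differences_partial_sum_cycle x : x \in T -> x != 0%R ->
  (x \in differences partial_sum_cycle) /\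
  ((- x)%R \in differences partial_sum_cycle).
Proof.
move=> /(nthP 0%R)[j0 ltj <-]; pose j := Ordinal ltj.
(* Entry [j] joins vertex [j] to its cyclic predecessor; the first entry comes from the closing
   edge. *)
rewrite -[j0]/(val j) -(ord_predK j); set i := ord_pred j => /partial_sum_edge ie.
have eT : (partial_sum (ordS i) - partial_sum i = nth 0 T (ordS i))%R.
  by rewrite partial_sum_ordS addrC addKr.
rewrite -eT opprB; split; apply/imageP.
  by exists (partial_sum (ordS i), partial_sum i).
by exists (partial_sum i, partial_sum (ordS i)); rewrite // inE setUC.
Qed.

(** An ordered pair spanning an edge is a forward step [a i] or a backward step [b i], with at most
    [l] of each. Equality fails for [l = 1], which has no edge, and for [l = 2], where forward and
    backward steps coincide. *)
Lemma size_differences_partial_sum_cycle :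
  size (differences partial_sum_cycle) <= 2 * l.
Proof.
pose a (i : 'I_l) := (partial_sum i, partial_sum (ordS i)).
pose b (i : 'I_l) := (partial_sum (ordS i), partial_sum i).
rewrite size_image.
apply: (@leq_trans #|[set a i | i : 'I_l] :|: [set b i | i : 'I_l]|).
  apply/subset_leq_card/subsetP => -[x y]; rewrite !inE /=.
  case/imsetP => e /setIdP[/imsetP[i _ ->] _].
  rewrite imsetU !imset_set1 => /eq_set2[] [-> ->].
    by rewrite [_ \in _](imset_f a).
  by rewrite orbC [_ \in _](imset_f b).
apply: leq_trans (leq_card_setU _ _) _; rewrite mul2n -addnn.
by apply: leq_add; apply: leq_trans (leq_imset_card _ _) _; rewrite card_ord.
Qed.

End CycleOfOrdering.

Lemma cycle_of_simple_ordering (G : finZmodType) (l : nat) (B : seq G) :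
    0 < l -> size B = l -> (\sum_(x <- B) x = 0)%R -> has_simple_ordering B ->
  exists g : graph G,
    [/\ isomorphic g (cycle_graph l), size (differences g) <= 2 * l
      & {in B, forall x, x != 0%R ->
           (x \in differences g) /\ ((- x)%R \in differences g)}].
Proof.
move=> l_gt0 sB sumB [T eTB T_simple].
have sT : size T = l by rewrite (perm_size eTB).
have T_sum0 : (\sum_(x <- T) x = 0)%R by rewrite (perm_big _ eTB).
subst l; rewrite -sT in l_gt0 *; exists (partial_sum_cycle T_simple); split.
- exact: image_graph_isomorphic (Ordinal l_gt0).
- exact: size_differences_partial_sum_cycle.
- by move=> x; rewrite -(perm_mem eTB); apply: mem_differences_partial_sum_cycle.
Qed.

Lemma difference_family_of_blocks (v t p l : nat) (B : 'I_p -> seq 'Z_v)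
    (J : {group 'Z_v}) :
    0 < l -> 1 < v -> v = 2 * p * l + t -> t %| v -> #|J| = t ->
    (forall i, size (B i) = l) -> (forall i, \sum_(x <- B i) x = 0)%R ->
    (forall i, has_simple_ordering (B i)) ->
    (forall x, x \notin J -> exists i, x \in B i \/ (- x)%R \in B i) ->
  exists F, difference_family v t (cycle_graph l) 1 F.
Proof.
move=> l_gt0 v_gt1 ev t_dv cardJ sB sumB simB covB.
have [g gP] := fin_all_exists
  (fun i => cycle_of_simple_ordering l_gt0 (sB i) (sumB i) (simB i)).
pose F := [seq g i | i <- enum 'I_p]; exists F; split=> //; exists J => //.
have coverD : {subset enum (~: J) <= family_differences F}.
  move=> x; rewrite mem_enum inE => xJ.
  (* The unit of the additive group is 0, so 0 lies in [J]. *)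
  have x_neq0 : x != 0%R by apply: contraNneq xJ => ->; apply: group1.
  have [i xB] := covB x xJ; have [_ _ gD] := gP i.
  apply/flatten_mapP; exists (g i); first by rewrite map_f ?mem_enum.
  case: xB => /gD; first by case.
  by rewrite oppr_eq0 opprK => /(_ x_neq0)[].
have sizeD : size (family_differences F) <= size (enum (~: J)).
  rewrite -cardE cardsCs setCK cardJ card_ord Zp_cast //.
  have -> : v - t = p * (2 * l) by rewrite {1}ev addnK -mulnA mulnCA.
  rewrite size_flatten sumnE 3!big_map big_enum.
  rewrite -[p in p * _]card_ord -sum_nat_const.
  by apply: leq_sum => i _; have [] := gP i.
(* A duplicate-free list contained in a list that is no longer forces both to have the same elements
   and the second to be duplicate-free as well. *)
have [_ eqD] := uniq_min_size (enum_uniq _) coverD sizeD.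
have uniqD := leq_size_uniq (enum_uniq _) coverD sizeD.
split=> [h /mapP[i _ ->] | x xJ | x xJ]; first by have [] := gP i.
  by rewrite count_uniq_mem // -eqD mem_enum inE xJ.
by rewrite -eqD mem_enum inE xJ.
Qed.

(** Double counting of the filled cells; it provides [m * s = n * k]. *)
Lemma sum_size_row_col_entries (G : zmodType) (m n : nat)
    (A : 'M[option G]_(m, n)) :
  \sum_i size (row_entries A i) = \sum_j size (col_entries A j).
Proof.
under eq_bigr do rewrite size_pmap -sum1_count big_enum_cond big_mkcond.
under [RHS]eq_bigr do rewrite size_pmap -sum1_count big_enum_cond big_mkcond.
exact: exchange_big.
Qed.

Lemma mem_row_entries (G : zmodType) (m n : nat) (A : 'M[option G]_(m, n))
    i j x : A i j = Some x -> x \in row_entries A i.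
Proof. by move=> Aij; rewrite mem_pmap -Aij map_f ?mem_enum. Qed.

Lemma mem_col_entries (G : zmodType) (m n : nat) (A : 'M[option G]_(m, n))
    i j x : A i j = Some x -> x \in col_entries A j.
Proof. by move=> Aij; rewrite mem_pmap -Aij (map_f (fun i => A i j)) ?mem_enum. Qed.

Theorem proposition2p5 (m n s k t : nat) (m_gt0 : 0 < m) (n_gt0 : 0 < n)
    (s_gt0 : 0 < s) (k_gt0 : 0 < k) (t_gt0 : 0 < t) :
  (exists A : 'M[option 'Z_(2 * n * k + t)]_(m, n),
     heffter m n s k t A /\ simple_array A) ->
  (exists F : seq (graph 'Z_(2 * m * s + t)),
     difference_family (2 * m * s + t) t (cycle_graph s) 1 F) /\
  (exists F : seq (graph 'Z_(2 * n * k + t)),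
     difference_family (2 * n * k + t) t (cycle_graph k) 1 F).
Proof.
case=> A [[t_d [J cardJ [sR sC covA sumR sumC]]] [simR simC]].
have e_ms_nk : m * s = n * k.
  have := sum_size_row_col_entries A.
  rewrite (eq_bigr _ (fun i _ => sR i)) (eq_bigr _ (fun j _ => sC j)).
  by rewrite !sum_nat_const !card_ord.
have ev : 2 * m * s + t = 2 * n * k + t by rewrite -!mulnA e_ms_nk.
have v_gt1 : 1 < 2 * n * k + t.
  have nk_gt0 : 0 < n * k by rewrite muln_gt0 n_gt0.
  by rewrite -mulnA (leq_trans _ (leq_addr _ _)) // leq_pmulr.
have t_dv : t %| 2 * n * k + t by rewrite dvdn_addl.
split.
  (* The two moduli are equal, which moves the row family into the group holding the entries of
     [A]. *)
  rewrite ev.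
  apply: (@difference_family_of_blocks _ _ _ _ (row_entries A) J) => // x xJ.
  have [i [j [] /mem_row_entries xA]] := covA x xJ; exists i; auto.
apply: (@difference_family_of_blocks _ _ _ _ (col_entries A) J) => // x xJ.
have [i [j [] /mem_col_entries xA]] := covA x xJ; exists j; auto.
Qed.
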